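(* There are absolute constants $a,b$ such that for every $r\in\mathbb N\cup\{\infty\}$ and every finite graph $G$, \[\mathrm{dfw}_r(G)\le a\cdot\mathrm{fw}_{5r}(G)^3+b,\] where $5\cdot\infty=\infty$.
   Context: Graphs are finite, simple, undirected. A $k$-flip of $G$ is obtained by choosing a partition $\mathcal P$ of $V(G)$ into at most $k$ parts and, for some pairs $A,B$ of (possibly equal) parts, inverting adjacency of every pair of distinct $x\in A,y\in B$ (a $\mathcal P$-flip). For $S\subseteq V(G)$, the $S$-types are the classes of the partition of $V(G)$ in which $u,v$ are equivalent iff $N(u)\cap S=N(v)\cap S$; an $S$-definable flip is a $\mathcal P$-flip for $\mathcal P$ the partition into $S$-types, and a $k$-definable flip is an $S$-definable flip for some $S$ with $|S|\le k$. Flipper game of radius $r$ and width $k$: $G_0=G$, runner chooses $v_0$; in round $i\ge1$ the flipper announces a $k$-flip $G_i$ of $G$, runner moves from $v_{i-1}$ to $v_i$ along a path of length at most $r$ (any length if $r=\infty$) in $G_{i-1}$; flipper wins if $v_i$ is isolated in $G_i$; $\mathrm{fw}_r(G)$ is the least $k$ with a flipper winning strategy. The definable flipper game is identical except that the flipper must announce $k$-definable flips; $\mathrm{dfw}_r(G)$ is the least $k$ for which the flipper wins it. *)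

(* Defs.v *)
From mathcomp Require Import all_boot.
Set Implicit Arguments. Unset Strict Implicit. Unset Printing Implicit Defensive.

(* A finite simple graph: vertex type T : finType, adjacency e : rel T,
   symmetric and irreflexive.  Radii r : option nat, None = infinity. *)

Section Flipper.
Variables (T : finType) (e : rel T).

(* The P-flip of e, where the partition is given by the part-labelling p : T -> P
   and the chosen (unordered) pairs of parts {A,B} are those with F A B || F B A. *)
Definition flip_of (P : Type) (p : T -> P) (F : P -> P -> bool) : rel T :=
  fun x y => (x != y) && (e x y (+) (F (p x) (p y) || F (p y) (p x))).

Definition is_kflip (k : nat) (H : rel T) : Prop :=
  exists (p : T -> 'I_k) (F : 'I_k -> 'I_k -> bool),
    forall x y, H x y = flip_of p F x y.

Definition stype (S : {set T}) (x : T) : {set T} := [set y in S | e x y].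

Definition is_kdflip (k : nat) (H : rel T) : Prop :=
  exists (S : {set T}) (F : {set T} -> {set T} -> bool),
    #|S| <= k /\ forall x y, H x y = flip_of (stype S) F x y.

Fixpoint reachN (H : rel T) (n : nat) (v u : T) : bool :=
  match n with
  | 0 => u == v
  | n'.+1 => reachN H n' v u || [exists w, reachN H n' v w && H w u]
  end.

Definition reach (r : option nat) (H : rel T) (v u : T) : Prop :=
  match r with
  | Some m => reachN H m v u
  | None => exists m, reachN H m v u
  end.

Definition isolated (H : rel T) (u : T) : Prop := forall w, ~~ H u w.

(* fwin allowed r n H v : the flipper, allowed to announce graphs satisfying
   [allowed], wins within n more rounds from the position where the previous
   announced graph is H and the runner sits at v. *)
Fixpoint fwin (allowed : rel T -> Prop) (r : option nat) (n : nat)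
  (H : rel T) (v : T) : Prop :=
  match n with
  | 0 => False
  | n'.+1 => exists H' : rel T, allowed H' /\
      forall u, reach r H v u -> isolated H' u \/ fwin allowed r n' H' u
  end.

Definition flipper_wins (r : option nat) (k : nat) : Prop :=
  forall v0 : T, exists n, fwin (is_kflip k) r n e v0.

Definition dflipper_wins (r : option nat) (k : nat) : Prop :=
  forall v0 : T, exists n, fwin (is_kdflip k) r n e v0.

Definition is_fw (r : option nat) (k : nat) : Prop :=
  flipper_wins r k /\ forall k', flipper_wins r k' -> k <= k'.

Definition is_dfw (r : option nat) (k : nat) : Prop :=
  dflipper_wins r k /\ forall k', dflipper_wins r k' -> k <= k'.

End Flipper.

Definition times5 (r : option nat) : option nat := omap (muln 5) r.

(* Main.v *)
(** If G' is a k-flip of G and the flipper wins with width k, then some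
    S-definable flip G'' with |S| = O(k^3) has all its edges between vertices at
    distance at most 5 in G'; announcing G'' instead of G' then wins the
    definable game.

    The set S comes from a duality: for sets X, B of vertices and the relation
    "flipped adjacency", either O(k) vertices of X are not all adjacent to a
    common b in B, or O(k) vertices of B dominate X. If both failed, then in
    every k-flip some part of X or of B would be a "hub" whose vertices pairwise
    have common neighbours, and hubs of consecutive k-flips are within distance
    3, so the runner would escape forever.

    S receives, for every part A, up to three greedily chosen vertices of A pairwise at
    distance more than 2 in G', and, when fewer than three
    exist, the O(k) vertices given by the duality for the vertices of A near each
    of them against every part. Then whether two vertices at distance more than 5
    in G' are adjacent in G depends only on their S-types. *)
Require Import Defs.
From mathcomp Require Import all_boot.
From mathcomp Require Import zify.
Set Implicit Arguments. Unset Strict Implicit. Unset Printing Implicit Defensive.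

Lemma card_bigcup_leq (I T : finType) (A : {set I}) (F : I -> {set T}) m :
  (forall i, i \in A -> #|F i| <= m) -> #|\bigcup_(i in A) F i| <= #|A| * m.
Proof.
move=> leFm; rewrite -sum_nat_const.
elim/big_rec2: _ => [|i n B Ai leBn]; first by rewrite cards0.
by rewrite cardsU (leq_trans (leq_subr _ _)) // leq_add ?leFm.
Qed.

(** * Walks of bounded length *)

Section Reachability.
Variable T : finType.
Implicit Types (H K : rel T) (x y z : T).

Lemma reachN_refl H n x : reachN H n x x.
Proof. by elim: n => [|n IH] /=; [exact: eqxx | rewrite IH]. Qed.

Lemma reachN_leq H m n x y : m <= n -> reachN H m x y -> reachN H n x y.
Proof.
move/subnK <-; elim: (n - m) => [//|d IH] Hm.
by rewrite addSn /= IH.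
Qed.

Lemma reachN_trans H m n x y z :
  reachN H m x y -> reachN H n y z -> reachN H (m + n) x z.
Proof.
move=> Hxy; elim: n z => [|n IH] z; first by rewrite addn0 => /eqP ->.
rewrite addnS /= => /orP[/IH -> //|/existsP[w /andP[/IH Hw Hwz]]].
by apply/orP; right; apply/existsP; exists w; rewrite Hw.
Qed.

Lemma reachN1 H x y : H x y -> reachN H 1 x y.
Proof.
by move=> Hxy; apply/orP; right; apply/existsP; exists x; rewrite /= eqxx.
Qed.

Lemma reachN_sym H n x y : symmetric H -> reachN H n x y = reachN H n y x.
Proof.
move=> symH; suff imp a b : reachN H n a b -> reachN H n b a.
  by apply/idP/idP; apply: imp.
elim: n a b => [|n IH] a b /=; first by rewrite eq_sym.
case/orP=> [/IH -> //|/existsP[w /andP[/IH Hw Hwb]]].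
have Hbw : reachN H 1 b w by apply: reachN1; rewrite symH.
exact: (reachN_trans Hbw Hw).
Qed.

Lemma reachN_mul H K m n x y :
    (forall a b, H a b -> reachN K m a b) ->
  reachN H n x y -> reachN K (m * n) x y.
Proof.
move=> HK; elim: n y => [|n IH] y; first by rewrite muln0.
rewrite mulnSr /= => /orP[/IH|/existsP[w /andP[/IH Hw /HK Hwy]]].
  exact/reachN_leq/leq_addr.
exact: reachN_trans Hw Hwy.
Qed.

Lemma reachN_isolated H n x y : isolated H x -> reachN H n x y -> y = x.
Proof.
move=> isoH; elim: n y => [|n IH] y /=; first by move/eqP.
case/orP=> [/IH //|/existsP[w /andP[/IH -> ]]].
by rewrite (negbTE (isoH y)).
Qed.

End Reachability.

(* Unlike in [flip_of], loops are flipped too; this removes case distinctions on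
   equality of vertices and changes no distance. *)
Definition loopy_flip (T : finType) (e : rel T) (P : Type) (p : T -> P)
    (F : P -> P -> bool) : rel T :=
  fun x y => e x y (+) (F (p x) (p y) || F (p y) (p x)).

Lemma loopy_flip_sym (T : finType) (e : rel T) (P : Type) (p : T -> P) F :
  symmetric e -> symmetric (loopy_flip e p F).
Proof. by move=> syme x y; rewrite /loopy_flip syme orbC. Qed.

Lemma reachN_loopy_flip (T : finType) (e : rel T) (P : Type) (p : T -> P) F
    (H : rel T) n x y :
    (forall a b, H a b = flip_of e p F a b) ->
  reachN (loopy_flip e p F) n x y -> reachN H n x y.
Proof.
move=> defH; rewrite -[in X in _ -> X](mul1n n); apply: reachN_mul => a b Eab.
have [->|neq_ab] := eqVneq a b; first exact: reachN_refl.
by apply: reachN1; rewrite defH /flip_of neq_ab.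
Qed.

(** * Entangled sets and the runner's escape *)

Section Entanglement.
Variables (T : finType) (e : rel T).
Hypothesis syme : symmetric e.
Variables (k : nat) (Z : bool -> {set T}) (c : bool).

(* [Z true] and [Z false] play the roles of X and B; the duality fails for them. *)
Definition entangled := forall s (Z0 : {set T}),
  Z0 \subset Z s -> #|Z0| <= 2 * k ->
  exists2 w, w \in Z (~~ s) & forall u, u \in Z0 -> e u w = c (+) s.

Hypothesis entZ : entangled.

(** If every part [j] had a pair with no suitable [w] in [j], these pairs would form a set of at
    most [2 * k] vertices, and the [w] given for it by [entangled] would suit the pair of its own
    part. *)
Lemma entangled_part (p : T -> 'I_k) s : exists j, forall u1 u2,
  u1 \in Z s -> u2 \in Z s ->
  exists w, [/\ w \in Z (~~ s), p w = j, e u1 w = c (+) s & e u2 w = c (+) s].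
Proof.
pose good j u1 u2 :=
  [exists w, [&& w \in Z (~~ s), p w == j, e u1 w == c (+) s & e u2 w == c (+) s]].
have [/existsP[j /forallP all_j]|] :=
  boolP [exists j, forall u1, forall u2, (u1 \in Z s) ==> (u2 \in Z s) ==> good j u1 u2].
  exists j => u1 u2 Zu1 Zu2; move/forallP: (all_j u1) => /(_ u2).
  by rewrite Zu1 Zu2 /= => /existsP[w /and4P[Zw /eqP ? /eqP ? /eqP ?]]; exists w.
rewrite negb_exists => /forallP none.
have [|f Pf] := @fin_all_exists _ (fun=> T * T)%type (fun j (u : T * T) =>
    [/\ u.1 \in Z s, u.2 \in Z s & ~~ good j u.1 u.2]).
  move=> j; move: (none j); rewrite negb_forall => /existsP[u1].
  rewrite negb_forall => /existsP[u2]; rewrite 2!negb_imply.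
  by case/and3P=> ? ? ?; exists (u1, u2).
pose Z0 := \bigcup_(j in [set: 'I_k]) [set (f j).1; (f j).2].
have [||w Zw Hw] := @entZ s Z0.
- by apply/bigcupsP => j _; rewrite subUset !sub1set; case: (Pf j) => -> ->.
- rewrite mulnC -[k in X in _ <= X]card_ord -cardsT; apply: card_bigcup_leq => j _.
  by rewrite cards2; case: (_ != _).
case: (Pf (p w)) => _ _ /existsP[]; exists w.
by rewrite Zw eqxx !Hw ?eqxx //; apply/bigcupP; exists (p w); rewrite // !inE eqxx ?orbT.
Qed.

Definition rich s (W : {set T}) := W \subset Z (~~ s) /\
  forall u1 u2, u1 \in Z s -> u2 \in Z s ->
  exists w, [/\ w \in W, e u1 w = c (+) s & e u2 w = c (+) s].

(* Any two vertices of a hub [U] have a common neighbour in [W]. *)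
Definition hub (E : rel T) s (U : {set T}) := exists W : {set T},
  [/\ rich s W, rich (~~ s) U,
      forall u w, u \in U -> w \in W -> E u w = (e u w == c (+) s),
      forall z, exists g, forall w, w \in W -> E z w = (e z w == g)
    & forall z, exists g, forall u, u \in U -> E z u = (e z u == g)].

Lemma hub_sub E s U : hub E s U -> U \subset Z s.
Proof. by case=> W [_ [+ _] _ _ _]; rewrite negbK. Qed.

Lemma hub_neq0 E s U : hub E s U -> exists u, u \in U.
Proof.
case=> W [_ [_ richU] _ _ _].
have [|| w Zw _] := @entZ s set0; rewrite ?sub0set ?cards0 //.
by have [u [Uu _ _]] := richU w w Zw Zw; exists u.
Qed.

(** Each side has a rich part; whether these two parts are flipped with each other decides which one
    is the hub. *)
Lemma hub_exists (p : T -> 'I_k) F : exists s U, hub (loopy_flip e p F) s U.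
Proof.
have [j1 P1] := entangled_part p true; have [j0 P0] := entangled_part p false.
pose j s := if s then j1 else j0; pose b := F j0 j1 || F j1 j0.
(* This solves [b = ~~ (c (+) s)], so that between the two parts the flip turns [e u w == c (+) s]
   into adjacency. *)
pose s := ~~ (c (+) b); pose Y s := [set w in Z (~~ s) | p w == j s].
have richY t : rich t (Y t).
  split; first by apply/subsetP => w; rewrite inE => /andP[].
  move=> u1 u2 Zu1 Zu2.
  have [w [Zw pw e1 e2]] : exists w, [/\ w \in Z (~~ t), p w = j t,
      e u1 w = c (+) t & e u2 w = c (+) t].
    by case: t Zu1 Zu2; [apply: P1 | apply: P0].
  by exists w; rewrite inE Zw pw eqxx.
have const_flip t z : exists g, forall w, w \in Y t ->
    loopy_flip e p F z w = (e z w == g).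
  exists (~~ (F (p z) (j t) || F (j t) (p z))) => w; rewrite inE => /andP[_ /eqP pw].
  by rewrite /loopy_flip pw; case: (e z w); case: (_ || _).
exists s, (Y (~~ s)), (Y s); split=> // u w.
rewrite !inE => /andP[_ /eqP pu] /andP[_ /eqP pw]; rewrite /loopy_flip pu pw.
have -> : F (j (~~ s)) (j s) || F (j s) (j (~~ s)) = b.
  by rewrite /b; case: (s) => //=; rewrite orbC.
by rewrite /s; case: (e u w); case: (c); case: (b).
Qed.

Lemma hub_common E s U u1 u2 : hub E s U -> u1 \in U -> u2 \in U ->
  exists2 w, E u1 w & E u2 w.
Proof.
move=> hubU U1 U2; have sUZ := subsetP (hub_sub hubU).
case: hubU => W [[_ richW] _ EUW _ _].
have [w [Ww e1 e2]] := richW u1 u2 (sUZ _ U1) (sUZ _ U2).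
by exists w; rewrite EUW ?e1 ?e2.
Qed.

Lemma hub_not_isolated E s U u : symmetric E -> hub E s U -> u \in U ->
  exists2 w, u != w & E u w.
Proof.
move=> symE hubU Uu; have sUZ := subsetP (hub_sub hubU).
have [u2 Uu2 neq_u] : exists2 u2, u2 \in U & u2 != u.
  case: hubU => W [[sWZ richW] [_ richU] _ _ _].
  have [w [Ww ew _]] := richW u u (sUZ _ Uu) (sUZ _ Uu).
  have [u2 [Uu2 ew2 _]] := richU w w (subsetP sWZ _ Ww) (subsetP sWZ _ Ww).
  exists u2 => //; apply: contra_eq_neq ew2 => ->.
  by rewrite [e w u]syme ew; case: (c); case: (s).
have [w Euw Eu2w] := hub_common hubU Uu Uu2.
(* If the common neighbour is [u] itself, the edge found at [u] is only a loop, but then [u2] is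
   adjacent to [u]. *)
have [eq_uw|] := eqVneq u w; last by exists w.
by exists u2; rewrite 1?eq_sym // symE eq_uw.
Qed.

(** Only the richness of [U'] matters, and it does not depend on the flip; so [U'] can be reached
    inside the old flip [E]. *)
Lemma hub_walk E E' s s' U U' u : symmetric E ->
    hub E s U -> hub E' s' U' -> u \in U ->
  exists2 u', u' \in U' & reachN E 3 u u'.
Proof.
move=> symE hubU hubU' Uu; have sUZ := subsetP (hub_sub hubU).
have sUZ' := subsetP (hub_sub hubU').
have step a b : E a b -> reachN E 1 a b by exact: reachN1.
have step2 a b d : E a b -> E d b -> reachN E 2 a d.
  by move=> Eab Edb; apply: (@reachN_trans _ _ 1 1 _ b); apply: step; rewrite // symE.
have nbool (x y : bool) : x != y -> x = ~~ y by case: x; case: y.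
case: hubU' => W' [_ [_ richU'] _ _ _].
case: (hubU) => W [[sWZ richW] [_ richU] EUW homW homU].
have [eqs|/nbool eqs] := eqVneq s' s.
  (* On the same side, [u] and [z] have a common neighbour in [W] for either value of [g]: one given
     by the richness of [W], or [b]. *)
  subst s'; have [b [Wb eub _]] := richW u u (sUZ _ Uu) (sUZ _ Uu).
  have Zb := subsetP sWZ _ Wb.
  have [z [Uz ezb _]] := richU' b b Zb Zb.
  exists z => //; apply: (@reachN_leq _ _ 2) => //.
  have [g Hg] := homW z; have [eqg|/nbool eqg] := eqVneq g (c (+) s).
    have [w [Ww euw ezw]] := richW u z (sUZ _ Uu) (sUZ' _ Uz).
    by apply: (step2 _ w); [rewrite EUW // euw | rewrite Hg // ezw eqg].
  apply: (step2 _ b); first by rewrite EUW // eub.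
  by rewrite Hg // syme ezb eqg; case: (c); case: (s).
(* On opposite sides, [z] is adjacent to [u] or to some [u2] in [U], which shares a neighbour with
   [u]. *)
subst s'; rewrite negbK in richU'.
have [z [Uz ezu _]] := richU' u u (sUZ _ Uu) (sUZ _ Uu).
exists z => //; have [g Hg] := homU z.
have [eqg|/nbool eqg] := eqVneq g (c (+) s).
  apply: (@reachN_leq _ _ 1) => //; apply: step; rewrite symE Hg // syme.
  by rewrite ezu eqg.
have Zz := sUZ' _ Uz; have [u2 [Uu2 ezu2 _]] := richU z z Zz Zz.
have [w Euw Eu2w] := hub_common hubU Uu Uu2.
apply: (@reachN_trans _ _ 2 1 _ u2); first exact: step2 Euw Eu2w.
by apply: step; rewrite symE Hg // ezu2 eqg; case: (c); case: (s).
Qed.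

Lemma entangled_runner_wins r : 0 < k ->
    (forall (H : rel T) x y, reachN H 3 x y -> reach r H x y) ->
  irreflexive e -> ~ flipper_wins e r k.
Proof.
move=> k_gt0 le3r irre wins.
have runner n (p : T -> 'I_k) F H s U v : (forall x y, H x y = flip_of e p F x y) ->
    hub (loopy_flip e p F) s U -> v \in U -> ~ fwin (is_kflip e k) r n H v.
  elim: n p F H s U v => [|n IH] p F H s U v defH hubU Uv; first by [].
  case=> H' [[p' [F' defH']] win].
  have [s' [U' hubU']] := hub_exists p' F'.
  have [u Uu' vu] := hub_walk (loopy_flip_sym p F syme) hubU hubU' Uv.
  case: (win u (le3r _ _ _ (reachN_loopy_flip defH vu))) => [iso|].
    have [w nuw Euw] := hub_not_isolated (loopy_flip_sym p' F' syme) hubU' Uu'.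
    by move: (iso w); rewrite defH' /flip_of nuw /= => /negP; apply.
  exact: IH defH' hubU' Uu'.
(* The initial graph counts as a flip with one part and nothing inverted, so the runner can start in
   a hub. *)
pose p (_ : T) := Ordinal k_gt0; pose F (_ _ : 'I_k) := false.
have [s [U hubU]] := hub_exists p F; have [v Uv] := hub_neq0 hubU.
have [n win] := wins v; apply: runner hubU Uv win => x y.
by rewrite /flip_of /F addbF; have [->|] := eqVneq x y.
Qed.

End Entanglement.

(** If no small subset of [X] or of [B] will do, the two sets are entangled and the runner escapes,
    against [wins]. *)
Lemma flip_duality (T : finType) (e : rel T) r k (X B : {set T}) c :
    symmetric e -> irreflexive e -> 0 < k ->
    (forall (H : rel T) x y, reachN H 3 x y -> reach r H x y) ->
    flipper_wins e r k ->
  exists2 D : {set T}, #|D| <= 2 * k &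
    (forall b, b \in B -> exists u, [/\ u \in D, u \in X & e u b = c]) \/
    (forall x, x \in X -> exists b, [/\ b \in D, b \in B & e x b = ~~ c]).
Proof.
move=> syme irre k_gt0 le3r wins.
pose Z s := if s then X else B.
pose avoids s (D : {set T}) := [forall w in Z (~~ s), exists u in D, e u w != c (+) s].
have [/existsP[s /existsP[D /and3P[sDZ leD /forall_inP DP]]]|none] :=
  boolP [exists s, exists D : {set T}, [&& D \subset Z s, #|D| <= 2 * k & avoids s D]].
  exists D => //; case: s sDZ DP => /= sDZ DP; [left | right] => z /DP/exists_inP[u Du eu].
    by exists u; rewrite Du (subsetP sDZ _ Du); split=> //; case: (e u z) eu; case: (c).
  exists u; rewrite Du (subsetP sDZ _ Du) syme; split=> //.
  by case: (e u z) eu; case: (c).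
case: (@entangled_runner_wins T e syme k Z c _ r) => // s D sDZ leD.
move: none; rewrite negb_exists => /forallP/(_ s); rewrite negb_exists => /forallP/(_ D).
rewrite sDZ leD /= negb_forall => /existsP[w]; rewrite negb_imply => /andP[Zw].
rewrite negb_exists => /forallP Dw; exists w => // u Du.
by apply/eqP; move: (Dw u); rewrite Du negbK.
Qed.

(** * A small set of vertices for a given flip *)

Section DefinableFlip.
Variables (T : finType) (e : rel T) (k : nat) (r : option nat).
Hypotheses (syme : symmetric e) (irre : irreflexive e) (k_gt0 : 0 < k).
Hypothesis le3r : forall (H : rel T) x y, reachN H 3 x y -> reach r H x y.
Hypothesis wins : flipper_wins e r k.
Variables (p : T -> 'I_k) (F : 'I_k -> 'I_k -> bool).

Let Fs i j := F i j || F j i.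
Let E : rel T := loopy_flip e p F.
Let symE : symmetric E := loopy_flip_sym p F syme.

Lemma Fs_sym i j : Fs i j = Fs j i.
Proof. exact: orbC. Qed.

(** Vertices that are not near have disjoint neighbourhoods in [E]; adjacency alone does not make
    them near. *)
Definition near x s := (x == s) || [exists z, E x z && E s z].

Lemma near_reach x s : near x s -> reachN E 2 x s.
Proof.
case/orP=> [/eqP-> | /existsP[z /andP[Exz Esz]]]; first exact: reachN_refl.
by apply: (@reachN_trans _ _ 1 1 _ z); apply: reachN1; rewrite // symE.
Qed.

(* The S-type of [y], for [S] containing a free subset of a part [i], determines
   whether the part of [y] is flipped with [i]. *)
Definition free (A : {set T}) :=
  forall y y', exists u, [/\ u \in A, ~~ E u y & ~~ E u y'].

(** The three neighbourhoods are pairwise disjoint, so [y] and [y'] are each adjacent to at most one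
    of the three vertices, and one is left over. *)
Lemma far_triple_free s1 s2 s3 :
  ~~ near s2 s1 -> ~~ near s3 s1 -> ~~ near s3 s2 -> free [set s1; s2; s3].
Proof.
have noE a b y : ~~ near a b -> E b y -> ~~ E a y.
  by rewrite negb_or negb_exists => /andP[_ /forallP/(_ y)] + Eby; rewrite Eby andbT.
move=> n21 n31 n32 y y'.
have pick a : a \in [set s1; s2; s3] -> ~~ E a y -> ~~ E a y' ->
    exists u, [/\ u \in [set s1; s2; s3], ~~ E u y & ~~ E u y'] by exists a.
have [i1 i2 i3] : [/\ s1 \in [set s1; s2; s3], s2 \in [set s1; s2; s3]
    & s3 \in [set s1; s2; s3]] by rewrite !inE !eqxx !orbT.
have [E1|N1] := boolP (E s1 y); have [E1'|N1'] := boolP (E s1 y').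
- exact: (pick s2 i2 (noE _ _ _ n21 E1) (noE _ _ _ n21 E1')).
- have [E2|N2] := boolP (E s2 y'); last exact: (pick s2 i2 (noE _ _ _ n21 E1) N2).
  exact: (pick s3 i3 (noE _ _ _ n31 E1) (noE _ _ _ n32 E2)).
- have [E2|N2] := boolP (E s2 y); last exact: (pick s2 i2 N2 (noE _ _ _ n21 E1')).
  exact: (pick s3 i3 (noE _ _ _ n32 E2) (noE _ _ _ n31 E1')).
- exact: (pick s1).
Qed.

Lemma free_or_covered (A : {set T}) : exists S : {set T},
  [/\ S \subset A, #|S| <= 3 &
      free S \/ (forall x, x \in A -> exists2 s, s \in S & near x s)].
Proof.
pose covers (S : {set T}) := [forall x in A, exists s in S, near x s].
have next S : covers S \/ exists x, x \in A /\ (forall s, s \in S -> ~~ near x s).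
  have [|] := boolP (covers S); first by left.
  rewrite negb_forall => /existsP[x]; rewrite negb_imply negb_exists.
  case/andP=> Ax /forallP Sx; right; exists x; split=> // s Ss.
  by move: (Sx s); rewrite Ss.
have covering (S : {set T}) : S \subset A -> #|S| <= 3 -> covers S -> exists S0 : {set T},
  [/\ S0 \subset A, #|S0| <= 3 &
      free S0 \/ (forall x, x \in A -> exists2 s, s \in S0 & near x s)].
  move=> sSA leS covS; exists S; split=> //; right=> x Ax.
  by have /exists_inP := forall_inP covS x Ax.
have [/covering|[s1 [A1 _]]] := next set0; first by apply; rewrite ?sub0set ?cards0.
have [/covering|[s2 [A2 n2]]] := next [set s1]; first by apply; rewrite ?sub1set ?cards1.
have [/covering|[s3 [A3 n3]]] := next [set s1; s2].
  by apply; rewrite ?subUset ?sub1set ?A1 // cards2; case: (_ != _).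
exists [set s1; s2; s3]; split; first by rewrite !subUset !sub1set A1 A2 A3.
  by rewrite setUC cardsU1 cards2; case: (_ \notin _); case: (_ != _).
by left; apply: far_triple_free; rewrite ?n2 ?n3 // !inE eqxx ?orbT.
Qed.

(** The last two cases are the sides of [flip_duality], read in [E], for the vertices near [s] in
    the part of [x] against the part [j]. *)
Definition flip_basis (S : {set T}) := forall x j,
  (exists2 S0 : {set T}, S0 \subset S & free S0 /\ forall s, s \in S0 -> p s = p x) \/
  exists s, [/\ s \in S, near x s, p s = p x &
    (forall b, p b = j -> exists u, [/\ u \in S, near u s, p u = p x & ~~ E u b]) \/
    (exists b, [/\ b \in S, p b = j & E x b])].

Lemma flip_basis_exists : exists2 S : {set T}, #|S| <= 9 * k ^ 3 & flip_basis S.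
Proof.
have [f Pf] := fin_all_exists (fun i => free_or_covered [set x | p x == i]).
have local s j : exists D : {set T}, #|D| <= 2 * k /\
   ((forall b, p b = j -> exists u, [/\ u \in D, near u s, p u = p s & ~~ E u b]) \/
   (forall x, p x = p s -> near x s -> exists b, [/\ b \in D, p b = j & E x b])).
  (* For this value of [c], [e u b = c] means non-adjacency in [E], and [e x b = ~~ c] adjacency. *)
  have [D leD HD] := flip_duality [set x | (p x == p s) && near x s]
    [set b | p b == j] (Fs (p s) j) syme irre k_gt0 le3r wins.
  exists D; split=> //; case: HD => HD; [left=> b pb | right=> x px xs].
    have [|u [Du + eub]] := HD b; first by rewrite inE pb.
    rewrite inE => /andP[/eqP pu us]; exists u; split=> //.
    by rewrite /E /loopy_flip eub pu pb -/(Fs _ _) addbb.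
  have [|b [Db + exb]] := HD x; first by rewrite inE px eqxx.
  rewrite inE => /eqP pb; exists b; split=> //.
  by rewrite /E /loopy_flip exb px pb -/(Fs _ _); case: (Fs _ _).
have [D PD] := fin_all_exists (fun s => fin_all_exists (local s)).
pose S1 := \bigcup_(i in [set: 'I_k]) f i.
pose S2 := \bigcup_(s in S1) \bigcup_(j in [set: 'I_k]) D s j.
have leS1 : #|S1| <= k * 3.
  rewrite -[k in X in _ <= X]card_ord -cardsT; apply: card_bigcup_leq => i _.
  by case: (Pf i).
have leS2 : #|S2| <= k * 3 * (k * (2 * k)).
  apply: leq_trans (leq_mul leS1 (leqnn _)); apply: card_bigcup_leq => s _.
  rewrite -[k in X in _ <= X * _]card_ord -cardsT; apply: card_bigcup_leq => j _.
  by case: (PD s j).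
(* The bound is [3 * k + 6 * k ^ 3], at most [9 * k ^ 3] because [k] is positive. *)
exists (S1 :|: S2); first by rewrite cardsU; nia.
have inS1 i s : s \in f i -> s \in S1 by move=> fs; apply/bigcupP; exists i.
have inS2 s j u : s \in S1 -> u \in D s j -> u \in S2.
  by move=> Ss Du; apply/bigcupP; exists s => //; apply/bigcupP; exists j.
move=> x j; have [sfA _ [freef|cov]] := Pf (p x).
  left; exists (f (p x)).
    by apply/subsetP => u /inS1; rewrite inE => ->.
  by split=> // s /(subsetP sfA); rewrite inE => /eqP.
right; have [|s fs xs] := cov x; first by rewrite inE.
have := subsetP sfA s fs; rewrite inE => /eqP ps; have Ss := inS1 _ _ fs.
exists s; split=> //; first by rewrite inE Ss.
case: (PD s j) => _ [HD|HD]; [left => b /HD[u [Du us pu Eub]] | right].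
  by exists u; rewrite inE (inS2 _ _ _ Ss Du) orbT -ps.
have [//|//|b [Db pb Exb]] := HD x; exists b.
by rewrite inE (inS2 _ _ _ Ss Db) orbT.
Qed.

(** * Adjacency between far vertices *)

Definition far x y := ~~ reachN E 5 x y.

Lemma far_sym x y : far x y = far y x.
Proof. by rewrite /far reachN_sym. Qed.

Lemma far_nonadjacent x y : far x y -> e x y = Fs (p x) (p y).
Proof.
move=> farxy; have : ~~ E x y.
  by apply: contra farxy => /reachN1; apply: reachN_leq.
by rewrite /E /loopy_flip -/(Fs _ _); case: (e x y); case: (Fs _ _).
Qed.

Section Consistency.
Variable S : {set T}.
Hypothesis basisS : forall x j,
  (exists2 S0 : {set T}, S0 \subset S & free S0 /\ forall s, s \in S0 -> p s = p x)
  \/ exists s, [/\ s \in S, near x s, p s = p x &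
     (forall b, p b = j -> exists u, [/\ u \in S, near u s, p u = p x & ~~ E u b]) \/
     (exists b, [/\ b \in S, p b = j & E x b])].

Lemma stype_eq x y u : stype e S x = stype e S y -> u \in S -> e x u = e y u.
Proof. by move/setP/(_ u); rewrite !inE => + Su; rewrite Su. Qed.

(* A vertex u in S from the part of x that is adjacent in G' to neither y nor y'
   proves the claim; if there is none, S has a vertex b in the part of y' that is
   adjacent in G' to x but too close to y' to be adjacent to x'. *)
Lemma row_consistent x x' y y' :
    far x y -> far x' y' -> stype e S x = stype e S x' -> stype e S y = stype e S y' ->
  Fs (p x) (p y') = Fs (p x') (p y') -> Fs (p x) (p y) = Fs (p x) (p y').
Proof.
move=> farxy farxy' eqx eqy eqF.
have link u : u \in S -> p u = p x -> ~~ E u y -> ~~ E u y' ->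
    Fs (p x) (p y) = Fs (p x) (p y').
  move=> Su pu; rewrite /E /loopy_flip -!/(Fs _ _) pu.
  rewrite [e u y]syme [e u y']syme (stype_eq eqy Su).
  by case: (e y' u); case: (Fs _ _); case: (Fs _ _).
have [[S0 sS0 [freeS0 pS0]]|[s [Ss xs ps HD]]] := basisS x (p y').
  have [u [S0u uy uy']] := freeS0 y y'.
  exact: link (subsetP sS0 u S0u) (pS0 u S0u) uy uy'.
(* The walk from [x] through [s] and [u] to [y] would have length 2 + 2 + 1, which [far] forbids. *)
have near_y u : near u s -> ~~ E u y.
  move/near_reach=> us; apply: contra farxy => /reachN1 uy.
  apply: (@reachN_trans _ _ 4 1 _ u) => //.
  by apply: (@reachN_trans _ _ 2 2 _ s); [exact: near_reach | rewrite reachN_sym].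
have [Esy'|] := boolP (E s y'); last by apply: link; rewrite // near_y // /near eqxx.
case: HD => [HD|[b [Sb pb Exb]]].
  by have [u [Su us pu uy']] := HD y' erefl; apply: link Su pu (near_y u us) uy'.
(* The walk from [x'] through [b], [x] and [s] to [y'] would have length 1 + 1 + 2 + 1. *)
have Ex'b : ~~ E x' b.
  apply: contra farxy' => /reachN1 x'b.
  apply: (@reachN_trans _ _ 1 4 _ b) => //; rewrite symE in Exb.
  apply: (@reachN_trans _ _ 1 3 _ x); first exact: reachN1.
  by apply: (@reachN_trans _ _ 2 1 _ s); [exact: near_reach | exact: reachN1].
move: Exb Ex'b; rewrite /E /loopy_flip -!/(Fs _ _) pb eqF (stype_eq eqx Sb).
by move=> ->.
Qed.

(** [Fs (p x) (p y')] mediates. If it differs from [Fs (p x') (p y')], then [row_consistent] with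
    the two sides exchanged shows that it also differs from [Fs (p x) (p y)], and Booleans that
    differ from a third are equal. *)
Lemma adjacency_consistent x x' y y' :
    far x y -> far x' y' -> stype e S x = stype e S x' -> stype e S y = stype e S y' ->
  e x y = e x' y'.
Proof.
move=> farxy farxy' eqx eqy; rewrite !far_nonadjacent //.
have [eqF|neqF] := eqVneq (Fs (p x) (p y')) (Fs (p x') (p y')).
  by rewrite (row_consistent farxy farxy').
rewrite far_sym in farxy'; rewrite far_sym in farxy.
have := row_consistent farxy' farxy (esym eqy) (esym eqx).
rewrite ![Fs (p y') _]Fs_sym ![Fs (p y) _]Fs_sym => impF.
move: neqF impF; case: (Fs (p x) (p y)); case: (Fs (p x) (p y')); case: (Fs (p x') (p y')) => //= _.
  by move=> /(_ erefl).
by move=> /(_ erefl).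
Qed.

(** One far adjacent pair suffices to invert a pair of types: by consistency all far pairs of these
    types are then adjacent, and inverting removes their edges. *)
Definition far_adjacent (t t' : {set T}) :=
  [exists x, exists y, [&& stype e S x == t, stype e S y == t', far x y & e x y]].

Lemma definable_flip_near x y :
  flip_of e (stype e S) far_adjacent x y -> reachN E 5 x y.
Proof.
case/andP=> neqxy; apply: contraTT => farxy; rewrite -/(far x y) in farxy.
have [exy|nexy] := boolP (e x y).
  rewrite addTb negbK; apply/orP; left; apply/existsP; exists x; apply/existsP; exists y.
  by rewrite !eqxx farxy exy.
rewrite addFb negb_or; apply/andP; split; apply: contra nexy.
  case/existsP=> x' /existsP[y' /and4P[/eqP tx /eqP ty far' exy']].
  by rewrite (adjacency_consistent farxy far').
case/existsP=> x' /existsP[y' /and4P[/eqP tx /eqP ty far' exy']].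
rewrite far_sym in farxy.
by rewrite syme (adjacency_consistent farxy far').
Qed.

End Consistency.
End DefinableFlip.

(** * Transfer to the definable game *)

Lemma definable_flip (T : finType) (e : rel T) k r (H : rel T) :
    symmetric e -> irreflexive e -> 0 < k ->
    (forall (K : rel T) x y, reachN K 3 x y -> reach r K x y) ->
    flipper_wins e r k -> is_kflip e k H ->
  exists H' : rel T, [/\ is_kdflip e (9 * k ^ 3) H', irreflexive H'
    & forall x y, H' x y -> reachN H 5 x y].
Proof.
move=> syme irre k_gt0 le3r wins [p [F defH]].
have [S leS basisS] := flip_basis_exists syme irre k_gt0 le3r wins p F.
exists (flip_of e (stype e S) (far_adjacent e p F S)); split.
- by exists S, (far_adjacent e p F S).
- by move=> x; rewrite /flip_of eqxx.
- move=> x y /(definable_flip_near syme basisS).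
  exact: reachN_loopy_flip.
Qed.

(** Each edge of [H'] is a walk of length at most 5 in [H], so a move of length [r] in [H'] is a
    move of length [5r] in [H]. A vertex isolated in [J] could only be adjacent to itself in [J'],
    which is irreflexive. *)
Lemma dflipper_simulates (T : finType) (e : rel T) k K r (H H' : rel T) n v :
    (forall J, is_kflip e k J -> exists J' : rel T, [/\ is_kdflip e K J', irreflexive J'
      & forall x y, J' x y -> reachN J 5 x y]) ->
    (forall x y, H' x y -> reachN H 5 x y) ->
  fwin (is_kflip e k) (times5 r) n H v -> fwin (is_kdflip e K) r n H' v.
Proof.
move=> defin; elim: n H H' v => [//|n IH] H H' v H'H /= [J [/defin[J' [dJ' irrJ' J'J]] win]].
exists J'; split=> // u vu.
have /win[iso|] : reach (times5 r) H v u; last by right; apply: IH J'J _.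
  case: r vu {win IH} => [m|[m]] /= /(reachN_mul H'H) //; by exists (5 * m).
left=> w; apply/negP => J'uw; move: (J'J _ _ J'uw) => /(reachN_isolated iso) eq_wu.
by rewrite eq_wu irrJ' in J'uw.
Qed.

(** The runner cannot move, so isolating [v] wins: inverting between neighbours and non-neighbours
    of [v], the latter including [v], removes all its edges. *)
Lemma dflipper_wins_radius0 (T : finType) (e : rel T) :
  symmetric e -> irreflexive e -> dflipper_wins e (Some 0) 1.
Proof.
move=> syme irre v; exists 1, (flip_of e (stype e [set v]) (fun A B : {set T} => (v \in A) && (v \notin B))).
split.
  by exists [set v], (fun A B : {set T} => (v \in A) && (v \notin B)); rewrite cards1.
move=> u /eqP ->; left=> w; rewrite /flip_of !inE eqxx /= irre [e w v]syme /=.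
by rewrite andbT addbb andbF.
Qed.

Theorem mainTheorem15 :
  exists a b : nat,
    forall (r : option nat) (T : finType) (e : rel T),
      symmetric e -> irreflexive e ->
      forall f d : nat,
        is_fw e (times5 r) f -> is_dfw e r d ->
        d <= a * f ^ 3 + b.
Proof.
exists 9, 1 => r T e syme irre f d [wins _] [_ min_d].
have [r0|r_neq0] := eqVneq r (Some 0).
  apply: leq_trans (min_d 1 _) (leq_addl _ _).
  by rewrite r0; exact: dflipper_wins_radius0.
apply: leq_trans (leq_addr _ _); apply: min_d => v.
(* The flip announced by the winning flipper labels [v] by an element of ['I_f]. *)
have f_gt0 : 0 < f.
  have [[|n]] := wins v; first by [].
  by case=> H [[p _] _]; apply: leq_ltn_trans (ltn_ord (p v)).
have le3r (H : rel T) x y : reachN H 3 x y -> reach (times5 r) H x y.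
  case: r r_neq0 {wins} => [[|m]|] // _; last by exists 3.
  by apply: reachN_leq; rewrite mulnS.
have [n win] := wins v; exists n; apply: dflipper_simulates win => [J|x y].
  exact: definable_flip syme irre f_gt0 le3r wins.
by move/reachN1; apply: reachN_leq.
Qed.
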